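(* Consider an $N$-DM team $(\mathcal{P}_N)$. Let the action spaces be convex and let the cost function $c$ be convex in its second and third arguments $\mathbb{P}$-almost surely. If the observations $v^1,\dots,v^N$ are exchangeable conditioned on $\omega_0$, then the team is symmetrically optimal.
   Context: Setting. All random variables live on a probability space $(\Omega,\mathcal{F},\mathbb{P})$; $n,m$ are positive integers. For $i=1,\dots,N$, decision maker $i$ (DM$^i$) observes an $\mathbb{R}^m$-valued random variable $v^i$, which is not affected by the action of any decision maker (the team is static), and applies the action $u^i=\gamma^i(v^i)$ in the action space $\mathbb{U}$, the same for all DMs (nominally $\mathbb{R}^n$, more generally a subset of $\mathbb{R}^n$ with the stated properties). $\Gamma^i$ is the set of admissible policies of DM$^i$, i.e. measurable functions $\gamma^i:\mathbb{R}^m\to\mathbb{U}$; $\mathbf{\Gamma}_N=\prod_{i=1}^N\Gamma^i$. $\omega_0$ is an exogenous $\Omega_0$-valued random variable and $c:\Omega_0\times\mathbb{R}^n\times\mathbb{R}^n\to\mathbb{R}_+$ is a Borel measurable cost function. Problem $(\mathcal{P}_N)$: minimize over $\underline\gamma_N=(\gamma^1,\dots,\gamma^N)\in\mathbf{\Gamma}_N$ the cost $J_N(\underline\gamma_N)=\frac1N\mathbb{E}\big[\sum_{i=1}^N c(\omega_0,u^i,\frac1N\sum_{p=1}^N u^p)\big]$ with $u^i=\gamma^i(v^i)$. A team is symmetrically optimal if for every given policy $\underline\gamma_N\in\mathbf{\Gamma}_N$ there exists an identically symmetric policy (each DM has the same policy), $(\tilde\gamma,\dots,\tilde\gamma)$,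 which performs at least as well, i.e. $J_N(\tilde\gamma,\dots,\tilde\gamma)\le J_N(\underline\gamma_N)$. Random variables $x^1,\dots,x^N$ are exchangeable if every permutation of the indices leaves their joint law unchanged; exchangeable conditioned on $\omega_0$ means that this holds for the conditional joint law given $\omega_0$, $\mathbb{P}$-almost surely. *)

(* Defs.v *)
From HB Require Import structures.
From mathcomp Require Import all_boot all_order all_algebra all_fingroup.
From mathcomp Require Import all_classical all_reals all_analysis.

Set Implicit Arguments.
Unset Strict Implicit.
Unset Printing Implicit Defensive.

Import Order.TTheory GRing.Theory Num.Theory.
Import numFieldNormedType.Exports.

Local Open Scope classical_set_scope.
Local Open Scope ring_scope.

(* R^n is 'rV[R]_n, with the Borel sigma-algebra of its (sup-norm) topology. *)
HB.instance Definition _ (R : realType) (n : nat) :=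
  @isMeasurable.Build (sigma_display (@open 'rV[R]_n)) 'rV[R]_n
    <<s @open 'rV[R]_n >> (@sigma_algebra0 _ setT (@open 'rV[R]_n))
    (@sigma_algebraC _ (@open 'rV[R]_n))
    (@sigma_algebra_bigcup _ setT (@open 'rV[R]_n)).

Section exchangeability.
Context {d : measure_display} {T : measurableType d} {R : realType} {N : nat}.

Definition permute_tuple (s : 'S_N) (x : N.-tuple T) : N.-tuple T :=
  [tuple tnth x (s i) | i < N].

Definition exchangeable_law (mu : set (N.-tuple T) -> \bar R) : Prop :=
  forall (s : 'S_N) (B : set (N.-tuple T)), measurable B ->
    pushforward mu (permute_tuple s) B = mu B.

End exchangeability.

Section conditional_law.
Context {d d0 d1 : measure_display} {Omega : measurableType d}
  {Omega0 : measurableType d0} {T : measurableType d1} {R : realType}.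
Variable P : probability Omega R.

(* K is a regular conditional distribution of X given omega0. *)
Definition is_cond_law (omega0 : Omega -> Omega0) (X : Omega -> T)
    (K : R.-pker Omega0 ~> T) : Prop :=
  forall (A : set Omega0) (B : set T), measurable A -> measurable B ->
    P (omega0 @^-1` A `&` X @^-1` B) =
    (\int[P]_(w in omega0 @^-1` A) K (omega0 w) B)%E.

End conditional_law.

Section conditional_exchangeability.
Context {d d0 d1 : measure_display} {Omega : measurableType d}
  {Omega0 : measurableType d0} {T : measurableType d1} {R : realType}.
Variable P : probability Omega R.

Definition joint_obs (N : nat) (v : 'I_N -> {RV P >-> T}) (w : Omega) :
    N.-tuple T :=
  [tuple v i w | i < N].

(* When T is standard Borel (as R^m is), K always exists and is unique up to
   null sets, so quantifying K existentially is no restriction. *)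
Definition cond_exchangeable (omega0 : {RV P >-> Omega0}) (N : nat)
    (v : 'I_N -> {RV P >-> T}) : Prop :=
  exists K : R.-pker Omega0 ~> (N.-tuple T),
    is_cond_law P omega0 (joint_obs v) K /\
    {ae P, forall w, exchangeable_law (K (omega0 w))}.

End conditional_exchangeability.

Section static_team.
Context {d d0 : measure_display} {Omega : measurableType d}
  {Omega0 : measurableType d0} {R : realType} {n m N : nat}.
Variable P : probability Omega R.

(* Since U need not be Borel, measurability is with respect to its trace
   sigma-algebra, i.e. measurability as a map into R^n. *)
Definition admissible (U : set 'rV[R]_n) (g : 'rV[R]_m -> 'rV[R]_n) : Prop :=
  measurable_fun setT g /\ forall y, U (g y).

(* The values lie in [0, +oo] when c is nonnegative. *)
Definition team_cost (omega0 : {RV P >-> Omega0})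
    (v : 'I_N -> {RV P >-> 'rV[R]_m})
    (c : Omega0 * 'rV[R]_n * 'rV[R]_n -> R)
    (gamma : 'I_N -> 'rV[R]_m -> 'rV[R]_n) : \bar R :=
  let u i w := gamma i (v i w) in
  ((N%:R^-1)%:E *
   'E_P[fun w => (\sum_(i < N)
      c (omega0 w, u i w, N%:R^-1 *: \sum_(p < N) u p w))%R])%E.

Definition symmetrically_optimal (U : set 'rV[R]_n)
    (omega0 : {RV P >-> Omega0}) (v : 'I_N -> {RV P >-> 'rV[R]_m})
    (c : Omega0 * 'rV[R]_n * 'rV[R]_n -> R) : Prop :=
  forall gamma : 'I_N -> 'rV[R]_m -> 'rV[R]_n,
    (forall i, admissible U (gamma i)) ->
    exists2 g : 'rV[R]_m -> 'rV[R]_n, admissible U g &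
      (team_cost omega0 v c (fun=> g) <= team_cost omega0 v c gamma)%E.

End static_team.

(* Main.v *)
Require Import Defs.
From HB Require Import structures.
From mathcomp Require Import all_boot all_order all_algebra all_fingroup.
From mathcomp Require Import all_classical all_reals all_analysis.
From mathcomp Require Import measurable_realfun.

Set Implicit Arguments.
Unset Strict Implicit.
Unset Printing Implicit Defensive.

Import Order.TTheory GRing.Theory Num.Theory.
Import numFieldNormedType.Exports.

Local Open Scope classical_set_scope.
Local Open Scope ring_scope.

(** Given policies gamma_0, ..., gamma_{N-1}, let every decision maker apply
their pointwise mean g = (1/N) sum_i gamma_i, which takes its values in U
because U is convex.  The reason g does at least as well is Jensen's inequality
over the N cyclic reassignments of the policies.  In the k-th reassignment,
decision maker i uses gamma_{i-k}, indices being taken modulo N.  For each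
fixed i, as k varies, i-k meets every index once, so the mean over k of the
action of i is g(v^i); hence the mean over k of the team averages is the team
average under g.  By joint convexity of c(omega0, _, _), the realized total
cost under g is therefore at most the mean over k of the realized total costs
of the reassigned profiles (total_cost_mean_policy_le).

Reassigning the policies amounts, after renaming the decision makers, to
keeping gamma and permuting the observations (total_cost_shift).  Conditional
exchangeability makes the joint law of omega0 and the observations invariant
under such a permutation (cond_exchangeable_integral), so all N reassigned
profiles have the same expected cost, namely that of gamma.

Cyclic shifts are used rather than the whole symmetric group because they
already move each index to every position equally often, and averaging over
them needs no count of permutations.  Costs are integrated in [0, +oo], so that
nothing has to be integrable; this only requires the realized costs to be
measurable, hence that averages of measurable vector-valued maps be
measurable. *)

(** * Measurability of maps into R^n *)

Section row_vector_measurability.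
Context {R : realType} {n : nat}.

Lemma measurable_row_coord (j : 'I_n) :
  measurable_fun [set: 'rV[R]_n] (fun x : 'rV[R]_n => x 0 j).
Proof.
apply: (measurability _ (RGenOpens.measurableE R)).
move=> _ [_ [a [b ->]] <-].
rewrite setTI; apply: sub_sigma_algebra.
apply: open_comp; last exact: interval_open.
by move=> x _; exact: coord_continuous.
Qed.

(** Countability of the index set, rational centre and radius 1/(k+1), is what
lets measurability be tested on balls, that is, on finitely many coordinates. *)
Lemma open_bigcup_rat_ball (A : set 'rV[R]_n) : open A ->
  A = \bigcup_(p in [set p : 'rV[rat]_n * nat |
         ball (map_mx ratr p.1 : 'rV[R]_n) p.2.+1%:R^-1 `<=` A])
        ball (map_mx ratr p.1 : 'rV[R]_n) p.2.+1%:R^-1.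
Proof.
move=> oA; apply/seteqP; split => [x Ax|x [p /= pA]]; last exact: pA.
move: oA; rewrite openE => /(_ _ Ax)/nbhs_ballP[e /= e0 xeA].
(* A ball of radius 1/(k+1) containing x lies within distance 2/(k+1) of x. *)
have [k ke] : exists k : nat, k.+1%:R^-1 < e / 2.
  have /ltr_add_invr[k] : 0 < e / 2 by rewrite divr_gt0.
  by rewrite add0r; exists k.
have k0 : 0 < k.+1%:R^-1 :> R by rewrite invr_gt0.
have /choice[q qx] (j : 'I_n) : exists q : rat,
    ball (x 0 j) k.+1%:R^-1 (ratr q).
  have [] := @dense_rat R (ball (x 0 j) k.+1%:R^-1).
  - by exists (x 0 j); exact: ballxx.
  - exact: ball_open.
  - by move=> y [xy [q _ qy]]; exists q; rewrite qy.
have xq : ball x k.+1%:R^-1 (map_mx ratr (\row_j q j) : 'rV[R]_n).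
  by split=> // i j; rewrite !mxE (ord1 i).
exists (\row_j q j, k) => /=; last exact: ball_sym.
move=> y qy; apply: xeA; apply: (@le_ball _ _ x (k.+1%:R^-1 + k.+1%:R^-1)).
  by rewrite [leRHS]splitr lerD// ltW.
exact: ball_triangle xq qy.
Qed.

(** A sup-norm ball is a finite intersection of conditions on single
coordinates, so its preimage is measurable; open sets follow by countable
unions. *)
Lemma measurable_fun_row d (T : measurableType d) (f : T -> 'rV[R]_n) :
  (forall j, measurable_fun setT (fun x => f x 0 j)) -> measurable_fun setT f.
Proof.
move=> mf; apply: (@measurability _ _ _ _ _ _ (@open 'rV[R]_n)) => //.
move=> _ [A /open_bigcup_rat_ball -> <-]; rewrite setTI preimage_bigcup.
rewrite bigcup_mkcond; apply: countable_bigcupT_measurable => //.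
move=> [q k]; case: ifPn => // _ /=.
rewrite (_ : _ @^-1` _ = \bigcap_(j in [set: 'I_n])
    ((fun x => f x 0 j) @^-1` ball (ratr (q 0 j) : R) k.+1%:R^-1)).
  apply: fin_bigcap_measurable => // j _; rewrite -[X in measurable X]setTI.
  apply: mf => //.
  apply: open_measurable.
  exact: ball_open.
apply/seteqP; split => x /=.
  by move=> [_ +] j _ => /(_ 0 j); rewrite mxE.
move=> h; split; first by rewrite invr_gt0.
by move=> i j; rewrite (ord1 i) mxE; exact: h.
Qed.

Lemma measurable_row_scale_sum d (T : measurableType d) (a : R) (I : Type)
    (s : seq I) (f : I -> T -> 'rV[R]_n) :
  (forall i, measurable_fun setT (f i)) ->
  measurable_fun setT (fun x => a *: \sum_(i <- s) f i x).
Proof.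
move=> mf; apply: measurable_fun_row => j.
under eq_fun do rewrite mxE summxE.
apply: measurable_funM => //; apply: measurable_sum => i.
exact: measurableT_comp (measurable_row_coord j) (mf i).
Qed.

End row_vector_measurability.

(** * Jensen's inequality for uniform means *)

Section convex_means.
Context {R : realType} {E : lmodType R}.

Let weight k : R := k.+1%:R / k.+2%:R.

Let weight_ge0 k : 0 <= weight k. Proof. by rewrite divr_ge0. Qed.

Let weight_le1 k : weight k <= 1.
Proof. by rewrite ler_pdivrMr ?mul1r ?ler_nat. Qed.

(** Convexity is given for two points only; a mean of k+2 points is a two-point
convex combination of the mean of the first k+1 points and the last one. *)
Let mean_recr (V : lmodType R) k (x : 'I_k.+2 -> V) :
  k.+2%:R^-1 *: \sum_i x i =
  weight k *: (k.+1%:R^-1 *: \sum_(i < k.+1) x (widen_ord (leqnSn _) i)) +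
  (1 - weight k) *: x ord_max.
Proof.
rewrite big_ord_recr scalerDr scalerA; congr (_ *: _ + _ *: _).
  by rewrite /weight mulrAC divff ?mul1r// pnatr_eq0.
apply: (@mulIf _ k.+2%:R); first by rewrite pnatr_eq0.
by rewrite mulrBl mul1r /weight -mulrA !mulVf ?pnatr_eq0// mulr1 -natrB// subSnn.
Qed.

Lemma convex_set_mean (D : set E) k (x : 'I_k.+1 -> E) :
  convex_set D -> (forall i, D (x i)) -> D (k.+1%:R^-1 *: \sum_i x i).
Proof.
move=> cD; elim: k x => [|k ih] x Dx.
  by rewrite big_ord1 invr1 scale1r.
rewrite mean_recr; have := @cD _ _ (Itv01 (weight_ge0 k) (weight_le1 k)).
move=> /(_ _ _ (mem_set (ih _ _)) (mem_set (Dx ord_max)))/set_mem.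
by apply=> i; exact: Dx.
Qed.

Lemma convex_function_mean (D : set E) (f : E -> R) k (x : 'I_k.+1 -> E) :
  convex_set D -> convex_function D (f : _ -> R^o) -> (forall i, D (x i)) ->
  f (k.+1%:R^-1 *: \sum_i x i) <= k.+1%:R^-1 * \sum_i f (x i).
Proof.
move=> cD cf; elim: k x => [|k ih] x Dx.
  by rewrite !big_ord1 invr1 scale1r mul1r.
have Dx' i : D (x (widen_ord (leqnSn k.+1) i)) by exact: Dx.
have -> : k.+2%:R^-1 * \sum_i f (x i) = _ := mean_recr (f \o x : _ -> R^o).
rewrite mean_recr; have := cf (Itv01 (weight_ge0 k) (weight_le1 k)).
move=> /(_ _ _ (mem_set (convex_set_mean cD Dx')) (mem_set (Dx ord_max))).
move=> /le_trans; apply; rewrite lerD2r.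
by apply: ler_wpM2l => //; exact: ih.
Qed.

End convex_means.

Lemma convex_setX (R : realType) (E F : lmodType R) (A : set E) (B : set F) :
  convex_set A -> convex_set B -> convex_set (A `*` B).
Proof.
move=> cA cB x y t /set_mem[Ax Bx] /set_mem[Ay By]; apply/mem_set; split.
  exact/set_mem/(cA x.1 y.1 t (mem_set Ax) (mem_set Ay)).
exact/set_mem/(cB x.2 y.2 t (mem_set Bx) (mem_set By)).
Qed.

(** * The joint law under conditional exchangeability *)

Section joint_law.
Context {d d0 d1 : measure_display} {Omega : measurableType d}
  {Omega0 : measurableType d0} {T : measurableType d1} {R : realType}.
Context {P : probability Omega R} {N : nat}.

Lemma measurable_permute_tuple (s : 'S_N) :
  measurable_fun setT (@permute_tuple _ T N s).
Proof.
apply/measurable_fun_tnthP => i.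
rewrite (_ : _ \o _ = (fun x => tnth x (s i))); first exact: measurable_tnth.
by apply/funext => x /=; rewrite tnth_mktuple.
Qed.

Lemma measurable_joint_obs (v : 'I_N -> {RV P >-> T}) :
  measurable_fun setT (joint_obs v).
Proof.
apply/measurable_fun_tnthP => i.
rewrite (_ : _ \o _ = v i :> (_ -> _)); first exact: measurable_funPT.
by apply/funext => x /=; rewrite tnth_mktuple.
Qed.

Variables (omega0 : {RV P >-> Omega0}) (v : 'I_N -> {RV P >-> T}).
Hypothesis v_exch : cond_exchangeable omega0 v.

(** Both sides are integrals over omega0 @^-1` A of the conditional law, taken at
the preimage of B under the permutation and at B itself; these integrands agree
almost surely. *)
Lemma joint_law_rectangle s A B : measurable A -> measurable B ->
  P (omega0 @^-1` A `&` (permute_tuple s \o joint_obs v) @^-1` B) =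
  P (omega0 @^-1` A `&` joint_obs v @^-1` B).
Proof.
move=> mA mB; have [K [KE Kexch]] := v_exch.
have mo C : measurable C -> measurable (omega0 @^-1` C).
  by move=> mC; rewrite -[X in measurable X]setTI; exact: measurable_funPT.
have mK C : measurable C ->
    measurable_fun (omega0 @^-1` A) (fun w => K (omega0 w) C).
  move=> mC; apply: measurable_funTS.
  exact: measurableT_comp (measurable_kernel K C mC) (measurable_funPT omega0).
have msB : measurable (permute_tuple s @^-1` B).
  by rewrite -[X in measurable X]setTI; exact: measurable_permute_tuple.
rewrite comp_preimage !KE//; apply: ge0_ae_eq_integral => //.
- exact: mo.
- exact: mK.
- exact: mK.
case: Kexch => C [mC PC sC]; exists C; split => // w /= h.
by apply: sC => /= e; apply: h => _; exact: e.
Qed.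

(** Rectangles form a pi-system generating the product sigma-algebra, so the
agreement on rectangles extends to the full joint laws of omega0 and the
observations, and then to integrals. *)
Lemma cond_exchangeable_integral s (f : Omega0 * N.-tuple T -> \bar R) :
  measurable_fun setT f -> (forall z, 0 <= f z)%E ->
  (\int[P]_w f (omega0 w, permute_tuple s (joint_obs v w)) =
   \int[P]_w f (omega0 w, joint_obs v w))%E.
Proof.
move=> mf f0.
pose Y w := (omega0 w, joint_obs v w).
pose Z w := (omega0 w, permute_tuple s (joint_obs v w)).
have mY : measurable_fun setT Y.
  apply: measurable_fun_pair; first exact: measurable_funPT.
  exact: measurable_joint_obs.
have mZ : measurable_fun setT Z.
  apply: measurable_fun_pair; first exact: measurable_funPT.
  exact: measurableT_comp (measurable_permute_tuple s) (measurable_joint_obs v).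
pose Y' : {mfun Omega >-> (Omega0 * N.-tuple T)%type} :=
  HB.pack Y (isMeasurableFun.Build _ _ _ _ _ mY).
pose Z' : {mfun Omega >-> (Omega0 * N.-tuple T)%type} :=
  HB.pack Z (isMeasurableFun.Build _ _ _ _ _ mZ).
transitivity (\int[pushforward P Z']_z f z)%E.
  by rewrite ge0_integral_pushforward.
transitivity (\int[pushforward P Y']_z f z)%E; last first.
  by rewrite ge0_integral_pushforward.
apply: eq_measure_integral => C mC _.
apply: (measure_unique [set A `*` B | A in measurable & B in measurable]
  (fun=> setT)) => //.
- exact: measurable_prod_measurableType.
- move=> _ _ [A1 mA1 [B1 mB1 <-]] [A2 mA2 [B2 mB2 <-]].
  exists (A1 `&` A2); first exact: measurableI.
  by exists (B1 `&` B2); [exact: measurableI|rewrite setXI].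
- by move=> _; exists setT => //; exists setT => //; rewrite setXTT.
- by rewrite bigcup_const//; exists 0%N.
- by move=> _ [A mA [B mB <-]]; exact: joint_law_rectangle.
- move=> _; rewrite /= /pushforward preimage_setT.
  by apply: (le_lt_trans (probability_le1 _ _)); rewrite ?ltry.
Qed.

End joint_law.

(** * Averaging a profile of policies over cyclic shifts *)

Section team.
Context {d d0 : measure_display} {Omega : measurableType d}
  {Omega0 : measurableType d0} {R : realType} {n m : nat}.
Context {P : probability Omega R}.
Variable (c : Omega0 * 'rV[R]_n * 'rV[R]_n -> R).
Hypothesis c_meas : measurable_fun setT c.
Hypothesis c_ge0 : forall x, 0 <= c x.

Definition total_cost N (gamma : 'I_N -> 'rV[R]_m -> 'rV[R]_n)
    (z : Omega0 * N.-tuple 'rV[R]_m) : R :=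
  \sum_(i < N) c (z.1, gamma i (tnth z.2 i),
    N%:R^-1 *: \sum_(p < N) gamma p (tnth z.2 p)).

Lemma total_cost_ge0 N (gamma : 'I_N -> 'rV[R]_m -> 'rV[R]_n) z :
  0 <= total_cost gamma z.
Proof. exact: sumr_ge0. Qed.

Lemma measurable_total_cost N (gamma : 'I_N -> 'rV[R]_m -> 'rV[R]_n) :
  (forall i, measurable_fun setT (gamma i)) ->
  measurable_fun setT (total_cost gamma).
Proof.
move=> mgamma.
have mu i : measurable_fun setT (fun z : Omega0 * N.-tuple 'rV[R]_m =>
    gamma i (tnth z.2 i)).
  apply: measurableT_comp => //.
  exact: measurableT_comp (measurable_tnth i) measurable_snd.
apply: measurable_sum => i; apply: measurableT_comp => //.
apply: measurable_fun_pair; last exact: measurable_row_scale_sum.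
exact: measurable_fun_pair.
Qed.

Lemma team_costE N (omega0 : {RV P >-> Omega0})
    (v : 'I_N -> {RV P >-> 'rV[R]_m}) gamma :
  team_cost omega0 v c gamma =
  (N%:R^-1%:E *
   \int[P]_w (total_cost gamma (omega0 w, joint_obs v w))%:E)%E.
Proof.
rewrite /team_cost unlock; congr (_ * _)%E; apply: eq_integral => w _.
rewrite /total_cost /=; congr _%:E; apply: eq_bigr => i _.
rewrite tnth_mktuple; congr (c (_, _, _ *: _)).
by apply: eq_bigr => p _; rewrite tnth_mktuple.
Qed.

Section cyclic_shifts.
Variable N : nat.
Implicit Type gamma : 'I_N.+1 -> 'rV[R]_m -> 'rV[R]_n.

Definition mean_policy gamma (y : 'rV[R]_m) : 'rV[R]_n :=
  N.+1%:R^-1 *: \sum_i gamma i y.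

(** The addition of indices is modulo N+1, so this is a cyclic shift. *)
Definition shift_perm (k : 'I_N.+1) : 'S_N.+1 := perm (@addIr _ k).

Lemma admissible_mean_policy (U : set 'rV[R]_n) gamma : convex_set U ->
  (forall i, admissible U (gamma i)) -> admissible U (mean_policy gamma).
Proof.
move=> cU admU; split; last first.
  by move=> y; apply: convex_set_mean => // i; have [] := admU i.
by apply: measurable_row_scale_sum => i; have [] := admU i.
Qed.

(** Renaming i + k into i turns a permutation of the observations into a
reassignment of the policies; the team average is unaffected by the renaming. *)
Lemma total_cost_shift gamma z k :
  total_cost gamma (z.1, permute_tuple (shift_perm k) z.2) =
  \sum_i c (z.1, gamma (i - k) (tnth z.2 i),
     N.+1%:R^-1 *: \sum_p gamma (p - k) (tnth z.2 p)).
Proof.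
rewrite [RHS](reindex_inj (@addIr _ k)); apply: eq_bigr => i _ /=.
rewrite addrK tnth_mktuple permE; congr (c (_, _, _ *: _)).
rewrite [RHS](reindex_inj (@addIr _ k)); apply: eq_bigr => p _ /=.
by rewrite addrK tnth_mktuple permE.
Qed.

(** For fixed i, the map k |-> i - k is a bijection of the indices. *)
Lemma mean_policyE gamma i y :
  mean_policy gamma y = N.+1%:R^-1 *: \sum_k gamma (i - k) y.
Proof. by congr (_ *: _); rewrite (reindex_inj (@subrI _ i)). Qed.

(** Jensen's inequality is applied, for each decision maker i, to the points
formed by the action of i and the team average in the k-th reassignment of the
policies; their mean over k is the corresponding pair under the mean policy. *)
Lemma total_cost_mean_policy_le (U : set 'rV[R]_n) gamma z :
  convex_set U ->
  convex_function (U `*` U)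
    (fun p : 'rV[R]_n * 'rV[R]_n => c (z.1, p.1, p.2) : R^o) ->
  (forall i y, U (gamma i y)) ->
  total_cost (fun=> mean_policy gamma) z <= N.+1%:R^-1 *
    \sum_k total_cost gamma (z.1, permute_tuple (shift_perm k) z.2).
Proof.
move=> cU cc Ugamma.
under [in leRHS]eq_bigr do rewrite total_cost_shift.
rewrite exchange_big mulr_sumr; apply: ler_sum => i _ /=.
pose x k : 'rV[R]_n * 'rV[R]_n := (gamma (i - k) (tnth z.2 i),
  N.+1%:R^-1 *: \sum_p gamma (p - k) (tnth z.2 p)).
have -> : (z.1, mean_policy gamma (tnth z.2 i),
    N.+1%:R^-1 *: \sum_p mean_policy gamma (tnth z.2 p)) =
    (z.1, (N.+1%:R^-1 *: \sum_k x k).1, (N.+1%:R^-1 *: \sum_k x k).2).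
  rewrite /= (raddf_sum fst) (raddf_sum snd) /=.
  congr (_, _, _ *: _); first exact: mean_policyE.
  rewrite -[RHS]scaler_sumr exchange_big scaler_sumr.
  by apply: eq_bigr => p _; rewrite (mean_policyE gamma p).
have := convex_function_mean (convex_setX cU cU) cc; apply => k.
by split => //=; apply: convex_set_mean.
Qed.

End cyclic_shifts.
End team.

Theorem theorem7 (R : realType) (d d0 : measure_display)
  (Omega : measurableType d) (Omega0 : measurableType d0)
  (P : probability Omega R) (n m N : nat)
  (n_gt0 : (0 < n)%N) (m_gt0 : (0 < m)%N) (N_gt0 : (0 < N)%N)
  (omega0 : {RV P >-> Omega0}) (v : 'I_N -> {RV P >-> 'rV[R]_m})
  (U : set 'rV[R]_n) (c : Omega0 * 'rV[R]_n * 'rV[R]_n -> R)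
  (c_meas : measurable_fun [set: Omega0 * 'rV[R]_n * 'rV[R]_n] c)
  (c_ge0 : forall x, 0 <= c x)
  (U_convex : convex_set U)
  (c_convex : {ae P, forall w : Omega,
     convex_function (U `*` U)
       (fun p : 'rV[R]_n * 'rV[R]_n => c (omega0 w, p.1, p.2))})
  (v_exch : cond_exchangeable omega0 v) :
  symmetrically_optimal U omega0 v c.
Proof.
case: N N_gt0 v v_exch => // N _ v v_exch gamma adm.
exists (mean_policy gamma); first exact: admissible_mean_policy.
have mgamma i : measurable_fun setT (gamma i) by have [] := adm i.
have [mmean _] := admissible_mean_policy U_convex adm.
rewrite !team_costE; apply: lee_wpmul2l; first by rewrite lee_fin.
pose F z := (total_cost c gamma z)%:E.
have mF : measurable_fun setT F.
  by apply/measurable_EFinP; exact: measurable_total_cost.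
have F0 z : (0 <= F z)%E by rewrite lee_fin total_cost_ge0.
have mobs : measurable_fun setT (joint_obs v) by exact: measurable_joint_obs.
have mpair (X : Omega -> N.+1.-tuple 'rV[R]_m) : measurable_fun setT X ->
    measurable_fun setT (fun w => (omega0 w, X w)).
  by move=> mX; apply: measurable_fun_pair => //; exact: measurable_funPT.
pose Fk k w := F (omega0 w, permute_tuple (shift_perm k) (joint_obs v w)).
have mFk k : measurable_fun setT (Fk k).
  apply: measurableT_comp => //; apply: mpair.
  exact: measurableT_comp (measurable_permute_tuple _) mobs.
have sumFk_ge0 w : [set: Omega] w -> (0 <= \sum_k Fk k w)%E.
  by move=> _; apply: sume_ge0 => k _; exact: F0.
(* By exchangeability every term of the mean over k integrates to the cost of
   gamma, so that cost may be replaced by the mean and compared pointwise. *)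
have <- : (\int[P]_w (N.+1%:R^-1%:E * \sum_k Fk k w) =
    \int[P]_w F (omega0 w, joint_obs v w))%E.
  rewrite ge0_integralZl_EFin//; last exact: emeasurable_sum.
  rewrite ge0_integral_sum//; last by move=> k w _; exact: F0.
  under eq_bigr do rewrite cond_exchangeable_integral//.
  rewrite sumr_const.
  rewrite card_ord -[X in (_ * X)%E]/(_ *+ _)%E -mule_natl muleA -EFinM.
  by rewrite mulVf ?pnatr_eq0// mul1e.
apply: ae_ge0_le_integral => //.
- by move=> w _; rewrite lee_fin total_cost_ge0.
- apply/measurable_EFinP.
  apply: (measurableT_comp _ (mpair _ mobs)).
  exact: measurable_total_cost.
- by move=> w _; rewrite mule_ge0 ?lee_fin ?sumFk_ge0.
- apply: measurable_funeM; exact: emeasurable_sum.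
have : forall w, convex_function (U `*` U)
    (fun p : 'rV[R]_n * 'rV[R]_n => c (omega0 w, p.1, p.2) : R^o) ->
   ((total_cost c (fun=> mean_policy gamma) (omega0 w, joint_obs v w))%:E <=
    N.+1%:R^-1%:E * \sum_k Fk k w)%E.
  move=> w cw; rewrite sumEFin -EFinM lee_fin.
  apply: (total_cost_mean_policy_le (z := (_, _)) U_convex cw) => i y.
  exact: (adm i).2.
move=> H; case: c_convex => C [mC PC sC]; exists C; split => // w /= h.
by apply: sC => /= /H.
Qed.
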